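(* Let $d\ge 1$, $q\ge 2$ and $j$ be integers with $d-\frac{d-1}{q}\le j\le d$, and with $j$ even if $q=2$. Let $n=q^d$ and let $L$ be the Laplacian matrix of the graph $H(d,q,j)$. Suppose that $$\lambda=q(q-1)^{j-1}\binom{d-1}{j-1}$$ is the largest eigenvalue $\lambda_{\max}(L)$ of $L$. Then the optimal value of the max-$q$-cut problem for $H(d,q,j)$ equals $$\frac{n(q-1)}{2q}\,\lambda_{\max}(L).$$
   Context: The graph $H(d,q,j)$ has as vertex set all $d$-tuples over an alphabet of size $q$ (so it has $n=q^d$ vertices), two vertices being adjacent if and only if they differ in exactly $j$ positions. The Laplacian matrix of a graph with adjacency matrix $A$ is $L=\operatorname{Diag}(Au_n)-A$, where $u_n$ is the all-ones vector of length $n$ and $\operatorname{Diag}(v)$ is the diagonal matrix with diagonal $v$. For an integer $k\ge 2$, the optimal value of the max-$k$-cut problem for a graph $G=(V,E)$ is the maximum, over all partitions of $V$ into at most $k$ subsets, of the number of edges joining vertices in different subsets. *)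

(* Defs.v *)
From HB Require Import structures.
From mathcomp Require Import all_boot all_order all_algebra.
From mathcomp Require Import reals.

Set Implicit Arguments.
Unset Strict Implicit.
Unset Printing Implicit Defensive.

Import Order.TTheory GRing.Theory Num.Theory.
Local Open Scope ring_scope.

Section Graphs.
Variables (R : realType) (T : finType).

(* Rows and columns are indexed by the ranks of the vertices in [enum T]. *)
Definition adjmx (e : rel T) : 'M[R]_#|T| :=
  \matrix_(i, k) (e (enum_val i) (enum_val k))%:R.

(* The transpose is only there because [diag_mx] expects a row vector. *)
Definition laplacian (e : rel T) : 'M[R]_#|T| :=
  diag_mx (adjmx e *m const_mx 1 : 'cV[R]_#|T|)^T - adjmx e.

(* An edge is an unordered pair of vertices, so each edge is counted once. *)
Definition edges (e : rel T) : {set {set T}} :=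
  [set [set p.1; p.2] | p in [set p : T * T | e p.1 p.2]].

Definition cut_edges (e : rel T) (P : {set {set T}}) : {set {set T}} :=
  [set E in edges e | [exists x in E, exists y in E, pblock P x != pblock P y]].

(* The blocks of a [partition] are nonempty, whence the bound [#|P| <= k]
   rather than an equality. *)
Definition max_k_cut (k : nat) (e : rel T) : nat :=
  \max_(P : {set {set T}} | partition P [set: T] && (#|P| <= k)%N)
    #|cut_edges e P|.

End Graphs.

Definition largest_eigenvalue (R : realType) (n : nat) (A : 'M[R]_n) (a : R) :=
  eigenvalue A a /\ forall b : R, eigenvalue A b -> b <= a.

Definition hamming_dist (d q : nat) (x y : d.-tuple 'I_q) : nat :=
  #|[set i : 'I_d | tnth x i != tnth y i]|.

Definition hamming_adj (d q j : nat) : rel (d.-tuple 'I_q) :=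
  fun x y => hamming_dist x y == j.
Arguments hamming_adj : clear implicits.

Lemma hamming_adj_sym d q j : symmetric (hamming_adj d q j).
Proof.
move=> x y; rewrite /hamming_adj /hamming_dist; congr (_ == _).
by apply: eq_card => i; rewrite !inE eq_sym.
Qed.

Lemma hamming_adj_irr d q j : (0 < j)%N -> irreflexive (hamming_adj d q j).
Proof.
move=> j_gt0 x; rewrite /hamming_adj /hamming_dist.
rewrite (eq_card0 (A := _)) => [|i]; last by rewrite !inE eqxx.
by case: j j_gt0.
Qed.

(* Main.v *)
(** The quadratic form of the Laplacian is bounded by its largest eigenvalue (via
    the spectral theorem over R[i]).  Summing this bound over the centered
    indicators of the blocks of a partition into at most q blocks, and bounding
    the sum of the squared block sizes below by n^2 / q, shows that every cut has
    at most n (q - 1) lambda_max / (2 q) edges.  Conversely, for the partition of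
    the q-ary words by their first letter, the cut edges are the pairs at distance
    j that differ in the first position, and counting them gives exactly this value. *)

Require Import Defs.
From mathcomp Require Import all_boot all_order all_algebra.
From mathcomp Require Import reals complex spectral sesquilinear.
From mathcomp Require Import ring lra.

Import Order.TTheory GRing.Theory Num.Theory.
Local Open Scope ring_scope.

(** * Quadratic forms and the largest eigenvalue *)

(** A real symmetric matrix is Hermitian over [R[i]], so a unitary change of basis turns the form
    into a sum of [D 0 i] times the squared modulus of [w 0 i], where each [D 0 i] is a real
    eigenvalue of [A]. *)
Lemma quadratic_form_le_eigenvalue_bound (R : rcfType) (n : nat) (A : 'M[R]_n) (a : R) :
  A^T = A -> (forall b, eigenvalue A b -> b <= a) ->
  forall v : 'rV[R]_n, (v *m A *m v^T) 0 0 <= a * (v *m v^T) 0 0.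
Proof.
move=> Asym le_a v.
pose f := real_complex R; pose B := map_mx f A.
have f_real (x : R) : f x \is Num.real by apply/complex_realP; exists x.
have Breal : B \is a mxOver Num.real by apply/mxOverP => i k; rewrite mxE.
have Bsym : B \is symmetricmx.
  apply/is_hermitianmxP; rewrite expr0 scale1r map_mx_id //.
  by rewrite /B map_trmx Asym.
have Bherm := realsym_hermsym Bsym Breal.
have Dreal := hermitian_spectral_diag_real Bherm.
have /orthomx_spectralP := hermitian_normalmx Bherm.
have Punitary := spectral_unitarymx B.
move: Dreal Punitary; move: (spectralmx B) (spectral_diag B) => P D Dreal Punitary BE.
have Punit := unitarymx_unit Punitary.
have DE i : exists2 r, D 0 i = f r & r <= a.
  have /complex_realP[r Dr] := mxOverP Dreal 0 i; exists r => //.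
  apply: le_a; rewrite -(eigenvalue_map f) -/B.
  apply/eigenvalueP; exists (row i P).
    by rewrite BE rowE !mulmxA mulmxK // -(rowE i (diag_mx D)) row_diag_mx -scalemxAl Dr -rowE.
  (* The row is nonzero: multiplying it by [invmx P] gives the [i]-th standard basis vector. *)
  apply/eqP => /(congr1 (mulmx^~ (invmx P))); rewrite mul0mx rowE mulmxK //.
  by move=> /rowP/(_ i)/eqP; rewrite !mxE !eqxx oner_eq0.
pose w := map_mx f v *m invmx P.
have fvE : map_mx f v = w *m P by rewrite mulmxKV.
have conj_f (x : R) : Num.conj (f x) = f x by apply/CrealP.
(* The inverse of a unitary matrix is its conjugate transpose, and conjugation fixes the real vector
   [map_mx f v]. *)
have fvTE : map_mx f v^T = invmx P *m map_mx Num.conj w^T.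
  rewrite invmx_unitary // -map_mxM -trmx_mul -fvE.
  apply/matrixP => i k; rewrite !mxE; exact: esym (conj_f _).
have quadE (d : 'rV_n) : (w *m diag_mx d *m map_mx Num.conj w^T) 0 0 =
    \sum_i d 0 i * (w 0 i * Num.conj (w 0 i)).
  rewrite mxE; apply: eq_bigr => i _.
  by rewrite mul_mx_diag !mxE mulrA [d 0 i * _]mulrC.
suff: f ((v *m A *m v^T) 0 0) <= f a * f ((v *m v^T) 0 0).
  by rewrite -rmorphM lecR.
have fE (M : 'M[R]_1) : f (M 0 0) = map_mx f M 0 0 by rewrite mxE.
rewrite !fE !map_mxM /= fvTE fvE -/B BE !mulmxA !mulmxK //.
have -> : (w *m map_mx Num.conj w^T) 0 0 = \sum_i w 0 i * Num.conj (w 0 i).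
  by rewrite mxE; apply: eq_bigr => i _; rewrite !mxE.
rewrite quadE mulr_sumr; apply: ler_sum => i _.
have [r -> le_ra] := DE i.
by rewrite ler_wpM2r ?mul_conjC_ge0 // lecR.
Qed.

(** * The Dirichlet form of the Laplacian *)

Lemma sum_enum_val (V : nmodType) (T : finType) (F : T -> V) :
  \sum_x F x = \sum_(i < #|T|) F (enum_val i).
Proof. by rewrite -big_enum_val; apply: eq_bigl => x. Qed.

Lemma laplacian_sym (R : realType) (T : finType) (e : rel T) :
  symmetric e -> (laplacian R e)^T = laplacian R e.
Proof.
move=> esym; rewrite linearB /= tr_diag_mx; congr (_ - _).
by apply/matrixP => i k; rewrite !mxE esym.
Qed.

Lemma laplacian_quadratic_form (R : realType) (T : finType) (e : rel T) (f : T -> R) :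
  symmetric e ->
  let v := \row_i f (enum_val i) in
  2 * (v *m laplacian R e *m v^T) 0 0 =
    \sum_x \sum_y (e x y)%:R * (f x - f y) ^+ 2.
Proof.
move=> esym v.
(* [S] is the degree part of the form and [M] the adjacency part. By symmetry both square terms of
   the expansion equal [S], whence the factor 2. *)
pose S := \sum_x \sum_y (e x y)%:R * f x ^+ 2.
pose M := \sum_x \sum_y (e x y)%:R * (f x * f y).
have SE : \sum_x \sum_y (e x y)%:R * f y ^+ 2 = S.
  rewrite exchange_big; apply: eq_bigr => x _; apply: eq_bigr => y _.
  by rewrite esym.
have -> : \sum_x \sum_y (e x y)%:R * (f x - f y) ^+ 2 = 2 * (S - M).
  rewrite mulrBr mulr_natl mulr2n -{2}SE /S /M mulr_sumr -big_split -sumrB.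
  apply: eq_bigr => x _ /=; rewrite mulr_sumr -big_split -sumrB.
  by apply: eq_bigr => y _ /=; ring.
congr (2 * _); rewrite mulmxBr mulmxBl !mxE; congr (_ - _).
  rewrite /S [RHS]sum_enum_val; apply: eq_bigr => i _.
  rewrite mul_mx_diag !mxE mulrAC -expr2 mulr_sumr [RHS]sum_enum_val.
  by apply: eq_bigr => k _; rewrite !mxE mulr1 mulrC.
rewrite /M exchange_big [RHS]sum_enum_val; apply: eq_bigr => i _.
rewrite !mxE mulr_suml [RHS]sum_enum_val.
by apply: eq_bigr => k _; rewrite !mxE; ring.
Qed.

Lemma dirichlet_form_le (R : realType) (T : finType) (e : rel T) (a : R) (f : T -> R) :
  symmetric e -> (forall b, eigenvalue (laplacian R e) b -> b <= a) ->
  \sum_x \sum_y (e x y)%:R * (f x - f y) ^+ 2 <= 2 * a * \sum_x f x ^+ 2.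
Proof.
move=> esym le_a.
rewrite -laplacian_quadratic_form // -mulrA ler_pM2l ?ltr0n //.
have Lsym := laplacian_sym R T e esym.
apply: le_trans (quadratic_form_le_eigenvalue_bound _ _ _ _ Lsym le_a _) _.
by rewrite mxE [in leRHS]sum_enum_val; under eq_bigr => i _ do rewrite !mxE -expr2.
Qed.

(** * Cut edges, partitions and the upper bound *)

(** A cut edge comes from exactly two ordered pairs, which are distinct because its ends lie in
    different blocks. *)
Lemma double_card_cut_edges (T : finType) (e : rel T) (P : {set {set T}}) :
  symmetric e ->
  (2 * #|cut_edges e P|)%N = #|[set p : T * T | e p.1 p.2 & pblock P p.1 != pblock P p.2]|.
Proof.
move=> esym; set D := [set p | _].
have -> : cut_edges e P = [set [set p.1; p.2] | p in D].
  apply/setP => E; rewrite inE; apply/andP/imsetP.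
    case=> /imsetP[[x y]]; rewrite inE /= => exy ->.
    case/'exists_andP=> x' [/set2P Ex' /'exists_andP[y' [/set2P Ey' ne]]].
    exists (x, y) => //; rewrite inE /= exy /=.
    by move: ne; case: Ex' => ->; case: Ey' => ->; rewrite ?eqxx // eq_sym.
  case=> [[x y]]; rewrite inE /= => /andP[exy ne] ->; split.
    by apply/imsetP; exists (x, y); rewrite ?inE.
  apply/'exists_andP; exists x; rewrite !inE eqxx; split=> //.
  by apply/'exists_andP; exists y; rewrite !inE eqxx orbT.
rewrite -[RHS]sum1_card (partition_big_imset (fun p : T * T => [set p.1; p.2])) /=.
rewrite mulnC -sum_nat_const; apply: eq_bigr => E /imsetP[[x y]].
rewrite inE /= => /andP[exy ne] ->.
have nxy : x != y by apply: contraNneq ne => ->.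
rewrite sum1_card; have <- : #|[set (x, y); (y, x)]| = 2%N.
  by rewrite cards2 xpair_eqE negb_and nxy.
apply: eq_card => -[x' y']; rewrite [RHS]unfold_in /= !inE /=; apply/idP/idP.
  move=> /orP[] /eqP[-> ->]; first by rewrite exy ne eqxx.
  by rewrite esym exy eq_sym ne setUC eqxx.
case/andP=> /andP[_ ne'] /eqP Exy.
have nxy' : x' != y' by apply: contraNneq ne' => ->.
have := set21 x' y'; rewrite Exy => /set2P Ex'.
have := set22 x' y'; rewrite Exy => /set2P Ey'.
move: nxy'; rewrite !xpair_eqE.
by case: Ex' => ->; case: Ey' => ->; rewrite ?eqxx ?orbT.
Qed.
Lemma card_set_pairs (T : finType) (r : rel T) :
  #|[set p : T * T | r p.1 p.2]| = (\sum_x \sum_y r x y)%N.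
Proof.
rewrite pair_bigA /= -sum1_card big_mkcond; apply: eq_bigr => p _.
by rewrite inE; case: (r _ _).
Qed.

Lemma mem_partition_block (T : finType) (P : {set {set T}}) (S : {set T}) (x : T) :
  partition P [set: T] -> S \in P -> (x \in S) = (pblock P x == S).
Proof.
case/and3P=> /eqP cP tP _ PS; apply/idP/eqP => [|<-].
  exact: def_pblock.
by rewrite mem_pblock cP inE.
Qed.

(** If the blocks of [x] and [y] differ, exactly these two blocks contribute 1 each; otherwise every
    term vanishes. *)
Lemma sum_block_indicators_sqr (R : realType) (T : finType) (P : {set {set T}}) (x y : T) :
  partition P [set: T] ->
  \sum_(S in P) ((x \in S)%:R - (y \in S)%:R) ^+ 2 = 2 * (pblock P x != pblock P y)%:R :> R.
Proof.
move=> partP; have /and3P[/eqP cP _ _] := partP.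
have Pb z : pblock P z \in P by rewrite pblock_mem // cP inE.
under eq_bigr => S PS do rewrite !(mem_partition_block T P S) //.
have [->|ne] := eqVneq (pblock P x) (pblock P y).
  by rewrite mulr0 big1 // => S _; rewrite subrr expr0n.
rewrite (bigD1 (pblock P x)) //= (bigD1 (pblock P y)) /=; last by rewrite Pb eq_sym.
rewrite big1 => [|S /andP[/andP[_ /negPf nx] /negPf ny]].
  by rewrite !eqxx [pblock P y == _]eq_sym (negPf ne) /=; ring.
by rewrite ![_ == S]eq_sym nx ny subrr expr0n.
Qed.

Lemma sum_centered_indicator_sqr (R : realType) (T : finType) (S : {set T}) :
  (0 < #|T|)%N ->
  \sum_x ((x \in S)%:R - #|S|%:R / #|T|%:R) ^+ 2 = #|S|%:R - #|S|%:R ^+ 2 / #|T|%:R :> R.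
Proof.
move=> T_gt0; have nT0 : #|T|%:R != 0 :> R by rewrite pnatr_eq0 -lt0n.
set c := _ / _.
under eq_bigr => x _.
  (* An indicator is its own square, so the expansion is affine in it. *)
  have -> : ((x \in S)%:R - c) ^+ 2 = (x \in S)%:R * (1 - 2 * c) + c ^+ 2.
    by case: (x \in S) => /=; ring.
  over.
rewrite big_split /= -mulr_suml sumr_const -natr_sum.
rewrite -[c ^+ 2 *+ _]mulr_natr -big_mkcond /= sum1_card /c.
by field.
Qed.

Lemma sum_sqr_card_partition (R : realType) (T : finType) (P : {set {set T}}) (k : nat) :
  partition P [set: T] -> (0 < k)%N -> (#|P| <= k)%N ->
  #|T|%:R ^+ 2 / k%:R <= \sum_(S in P) #|S|%:R ^+ 2 :> R.
Proof.
move=> partP k_gt0 leP.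
have k0 : k%:R != 0 :> R by rewrite pnatr_eq0 -lt0n.
have sumS : \sum_(S in P) #|S|%:R = #|T|%:R :> R.
  by rewrite -natr_sum -(card_partition partP) cardsT.
(* Deviations are taken from the mean size for [k] blocks rather than [#|P|]; the expansion then
   involves [#|P|] only through [#|P|%:R * c ^+ 2], which is at most [k%:R * c ^+ 2]. *)
set c : R := #|T|%:R / k%:R.
have : 0 <= \sum_(S in P) (#|S|%:R - c) ^+ 2 by apply: sumr_ge0 => S _; exact: sqr_ge0.
have -> : \sum_(S in P) (#|S|%:R - c) ^+ 2 =
    \sum_(S in P) #|S|%:R ^+ 2 - 2 * c * #|T|%:R + #|P|%:R * c ^+ 2.
  rewrite -sumS mulr_sumr -sumrB [#|P|%:R * _]mulr_natl -sumr_const -big_split.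
  by apply: eq_bigr => S _ /=; ring.
have lePc : #|P|%:R * c ^+ 2 <= k%:R * c ^+ 2 by rewrite ler_wpM2r ?sqr_ge0 ?ler_nat.
have -> : #|T|%:R ^+ 2 / k%:R = 2 * c * #|T|%:R - k%:R * c ^+ 2 by rewrite /c; field.
lra.
Qed.

(* Centering the indicators of the blocks leaves the Dirichlet form unchanged
   and lowers their squared norms, which makes the bound sharp. *)
Lemma cut_edges_le_eigenvalue_bound (R : realType) (T : finType) (e : rel T)
    (P : {set {set T}}) (k : nat) (a : R) :
  symmetric e -> (forall b, eigenvalue (laplacian R e) b -> b <= a) ->
  0 <= a -> (0 < #|T|)%N -> (0 < k)%N ->
  partition P [set: T] -> (#|P| <= k)%N ->
  #|cut_edges e P|%:R <= #|T|%:R * (k%:R - 1) / (2 * k%:R) * a.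
Proof.
move=> esym le_a a_ge0 T_gt0 k_gt0 partP leP.
have k0 : k%:R != 0 :> R by rewrite pnatr_eq0 -lt0n.
have T0 : #|T|%:R != 0 :> R by rewrite pnatr_eq0 -lt0n.
pose f (S : {set T}) x : R := (x \in S)%:R - #|S|%:R / #|T|%:R.
have : \sum_(S in P) \sum_x \sum_y (e x y)%:R * (f S x - f S y) ^+ 2
     <= \sum_(S in P) 2 * a * \sum_x f S x ^+ 2.
  by apply: ler_sum => S _; exact: dirichlet_form_le.
(* One factor 2 comes from ordered pairs, the other from the two blocks that separate the ends of a
   cut edge. *)
have -> : \sum_(S in P) \sum_x \sum_y (e x y)%:R * (f S x - f S y) ^+ 2
    = 4 * #|cut_edges e P|%:R.
  rewrite -[4]/((2 * 2)%:R) natrM -mulrA -natrM double_card_cut_edges //.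
  rewrite exchange_big (card_set_pairs T (fun x y => e x y && (pblock P x != pblock P y))).
  rewrite natr_sum mulr_sumr; apply: eq_bigr => x _.
  rewrite exchange_big natr_sum mulr_sumr; apply: eq_bigr => y _ /=; rewrite -mulr_sumr.
  under eq_bigr => S _ do rewrite /f opprB addrA addrNK.
  rewrite sum_block_indicators_sqr //.
  by case: (e x y); case: (_ != _); rewrite /= ?mulr1 ?mulr0 ?mul1r ?mul0r.
rewrite -mulr_sumr; under eq_bigr => S _ do rewrite sum_centered_indicator_sqr //.
rewrite sumrB -mulr_suml -natr_sum -(card_partition partP) cardsT => le_cut.
have := sum_sqr_card_partition R T P k partP k_gt0 leP.
move: (\sum_(S in P) _) le_cut => s le_cut le_s.
have : 2 * a * (#|T|%:R - s / #|T|%:R) <= 2 * a * (#|T|%:R - #|T|%:R / k%:R).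
  rewrite ler_wpM2l ?mulr_ge0 // lerD2l lerN2 ler_pdivlMr ?ltr0n //.
  by apply: le_trans le_s; rewrite mulrAC -expr2.
have -> : #|T|%:R * (k%:R - 1) / (2 * k%:R) * a =
  2 * a * (#|T|%:R - #|T|%:R / k%:R) / 4 by field.
lra.
Qed.

(** * Lower bound from a colouring *)

Lemma colouring_le_max_k_cut (T : finType) (k : nat) (e : rel T) (g : T -> 'I_k) :
  symmetric e ->
  (#|[set p : T * T | e p.1 p.2 & g p.1 != g p.2]| <= 2 * max_k_cut k e)%N.
Proof.
move=> esym; set P := preim_partition g [set: T].
have partP : partition P [set: T] by exact: preim_partitionP.
have pblockE x y : (pblock P x == pblock P y) = (g x == g y).
  rewrite eq_pblock; [|by case/and3P: partP|by case/and3P: partP => /eqP-> _ _; rewrite inE].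
  rewrite /P pblock_equivalence_partition ?inE // => u v w _ _ _ /=.
  by split=> // /eqP->.
have -> : [set p : T * T | e p.1 p.2 & g p.1 != g p.2] =
    [set p : T * T | e p.1 p.2 & pblock P p.1 != pblock P p.2].
  by apply/setP => p; rewrite !inE pblockE.
rewrite -double_card_cut_edges // leq_mul2l /=.
apply: (leq_bigmax_cond P); rewrite partP /=.
(* Every block is the fibre of some colour, so there are at most [k] blocks. *)
have : P \subset [set g @^-1: [set c] | c : 'I_k].
  apply/subsetP => S /imsetP[x _ ->]; apply/imsetP; exists (g x) => //.
  by apply/setP => y; rewrite !inE eq_sym.
move=> /subset_leq_card/leq_trans-> //.
by rewrite (leq_trans (leq_imset_card _ _)) // card_ord.
Qed.

(** * Counting pairs of words *)

Lemma card_tuple_family (T : finType) (d : nat) (F : 'I_d -> pred T) :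
  #|[set y : d.-tuple T | [forall i, F i (tnth y i)]]| = (\prod_i #|F i|)%N.
Proof.
pose h (f : {ffun 'I_d -> T}) := [tuple f i | i < d].
have hE f i : tnth (h f) i = f i by rewrite tnth_mktuple.
have -> : [set y : d.-tuple T | [forall i, F i (tnth y i)]] = h @: [set f in family F].
  apply/setP => y; rewrite inE; apply/forallP/imsetP => [Fy|[f Ff ->] i].
    have yE : y = h [ffun i => tnth y i].
      by apply: eq_from_tnth => i; rewrite hE ffunE.
    exists [ffun i => tnth y i] => //; rewrite inE.
    by apply/familyP => i; rewrite ffunE; apply: Fy.
  by rewrite hE; move: Ff; rewrite inE => /familyP/(_ i).
rewrite card_imset; last by move=> f g fg; apply/ffunP => i; rewrite -!hE fg.
by rewrite cardsE card_family foldrE big_map big_enum.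
Qed.

(** Each position in [B] allows every letter but that of [x]; each other position forces the letter
    of [x]. *)
Lemma card_tuples_differing_on (q d : nat) (x : d.-tuple 'I_q) (B : {set 'I_d}) :
  #|[set y : d.-tuple 'I_q | [set i | tnth x i != tnth y i] == B]| = (q.-1 ^ #|B|)%N.
Proof.
pose F i : pred 'I_q := fun c => (tnth x i != c) == (i \in B).
have -> : [set y : d.-tuple 'I_q | [set i | tnth x i != tnth y i] == B] =
    [set y | [forall i, F i (tnth y i)]].
  apply/setP => y; rewrite !inE; apply/eqP/forallP => [BE i|Fy].
    by rewrite /F -BE inE.
  by apply/setP => i; rewrite inE; exact: (eqP (Fy i)).
rewrite card_tuple_family (bigID (mem B)) /= [X in (_ * X)%N]big1 ?muln1.
  rewrite -prod_nat_const; apply: eq_bigr => i Bi.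
  have <- : #|predC1 (tnth x i)| = q.-1 by rewrite cardC1 card_ord.
  by apply: eq_card => c; rewrite !inE /F unfold_in Bi eqb_id eq_sym.
move=> i /negPf nBi; rewrite -(card1 (tnth x i)).
by apply: eq_card => c; rewrite !inE /F unfold_in nBi eqbF_neg negbK eq_sym.
Qed.

(** Adding [x] is a bijection from the [m]-subsets of the complement of [x] onto these sets. *)
Lemma card_sets_containing (T : finType) (x : T) (m : nat) :
  #|[set B : {set T} | (x \in B) && (#|B| == m.+1)]| = 'C(#|T|.-1, m).
Proof.
have <- : #|[set~ x]| = #|T|.-1 by rewrite cardsC1.
rewrite -cards_draws.
have -> : [set B : {set T} | (x \in B) && (#|B| == m.+1)] =
    (fun A => x |: A) @: [set A : {set T} | (A \subset [set~ x]) && (#|A| == m)].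
  apply/setP => B; rewrite inE; apply/andP/imsetP => [[xB cB]|[A]].
    exists (B :\ x); last by rewrite setD1K.
    rewrite inE subsetC sub1set !inE eqxx /=.
    by rewrite (cardsD1 x) xB in cB.
  rewrite inE subsetC sub1set inE => /andP[xA /eqP <-] ->.
  by rewrite setU11 cardsU1 xA.
rewrite card_in_imset // => A B; rewrite !inE.
rewrite subsetC sub1set inE => /andP[xA _].
rewrite subsetC sub1set inE => /andP[xB _] /(congr1 (fun C => C :\ x)).
by rewrite !setU1K.
Qed.

Lemma card_hamming_pairs_differing_at (q d m : nat) (i0 : 'I_d) :
  #|[set p : d.-tuple 'I_q * d.-tuple 'I_q |
      hamming_adj d q m.+1 p.1 p.2 & tnth p.1 i0 != tnth p.2 i0]| =
  (q ^ d * (q.-1 ^ m.+1 * 'C(d.-1, m)))%N.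
Proof.
rewrite (card_set_pairs _ (fun x y => hamming_adj d q m.+1 x y && (tnth x i0 != tnth y i0))).
have -> : (q ^ d = #|{: d.-tuple 'I_q}|)%N by rewrite card_tuple card_ord.
rewrite -sum_nat_const; apply: eq_bigr => x _.
(* For fixed [x], the words [y] are grouped by the set of positions where they differ from [x]; the
   relevant sets contain [i0] and have [m.+1] elements. *)
pose supp (y : d.-tuple 'I_q) := [set i | tnth x i != tnth y i].
pose good (B : {set 'I_d}) := (i0 \in B) && (#|B| == m.+1).
rewrite [LHS](_ : _ = \sum_(y | good (supp y)) 1)%N; last first.
  rewrite [RHS]big_mkcond; apply: eq_bigr => y _.
  by rewrite /good inE andbC -[hamming_adj _ _ _ _ _]/(#|supp y| == m.+1); case: (_ && _).
rewrite (partition_big supp good) //=.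
rewrite -[d in 'C(d.-1, _)]card_ord -(card_sets_containing _ i0) -sum1_card mulnC.
rewrite big_distrl /=; apply: eq_big => [B|B /andP[i0B /eqP cB]]; first by rewrite inE.
rewrite mul1n -cB -(card_tuples_differing_on _ _ x) -sum1_card.
apply: eq_bigl => y; rewrite inE; apply: andb_idl => /eqP ->.
by rewrite /good i0B cB eqxx.
Qed.

Theorem theorem10 (R : realType) (d q j : nat) (lambda : R)
    (hd : (1 <= d)%N) (hq : (2 <= q)%N)
    (hjlo : d%:R - (d%:R - 1) / q%:R <= j%:R :> R) (hjhi : (j <= d)%N)
    (hjeven : q = 2%N -> ~~ odd j)
    (hlambda : lambda =
       q%:R * (q%:R - 1) ^+ (j - 1) * ('C(d - 1, j - 1))%:R)
    (hmax : largest_eigenvalue (laplacian R (hamming_adj d q j)) lambda) :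
  (max_k_cut q (hamming_adj d q j))%:R =
    (q ^ d)%:R * (q%:R - 1) / (2 * q%:R) * lambda.
Proof.
have q_gt0 : (0 < q)%N by exact: ltnW.
have q0 : q%:R != 0 :> R by rewrite pnatr_eq0 -lt0n.
have qB1 : q%:R - 1 = q.-1%:R :> R by rewrite -subn1 natrB.
have esym := @hamming_adj_sym d q j.
have cardV : #|{: d.-tuple 'I_q}| = (q ^ d)%N by rewrite card_tuple card_ord.
(* Since [(d - 1) / q] is at most [d - 1], the lower bound on [j] is at least 1. *)
have j_gt0 : (0 < j)%N.
  have : 1 <= d%:R - (d%:R - 1) / q%:R :> R.
    rewrite lerBrDl -lerBrDr ler_pdivrMr ?ltr0n //.
    by rewrite ler_peMr ?subr_ge0 ?ler1n.
  by move=> /le_trans/(_ hjlo); rewrite ler1n.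
have lambda_ge0 : 0 <= lambda.
  by rewrite hlambda qB1 !mulr_ge0 ?exprn_ge0 ?ler0n.
apply/eqP; rewrite eq_le; apply/andP; split.
  apply: (big_ind (fun m : nat => m%:R <= _)) => [|m1 m2 le1 le2|P /andP[partP leP]].
  - by rewrite qB1 !mulr_ge0 ?invr_ge0 ?mulr_ge0 ?ler0n.
  - by rewrite /maxn; case: ifP.
  - have := cut_edges_le_eigenvalue_bound R _ _ P q lambda esym hmax.2 lambda_ge0.
    by rewrite cardV expn_gt0 q_gt0; apply.
(* Words are coloured by their first letter, at position [Ordinal hd]. *)
have := colouring_le_max_k_cut _ q (hamming_adj d q j) (fun x => tnth x (Ordinal hd)) esym.
case: j j_gt0 hlambda {hjlo hjhi hjeven hmax esym} => // m _ hlambda.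
rewrite card_hamming_pairs_differing_at -(ler_nat R) !natrM !natrX -qB1.
(* With [j = m.+1], the number of ordered pairs separated by this colouring is exactly twice the
   claimed value. *)
rewrite hlambda subn1 /= subn1 exprS => le_cut.
rewrite -(ler_pM2l (_ : 0 < 2 :> R)) //.
apply: le_trans le_cut; rewrite le_eqVlt; apply/orP; left; apply/eqP.
by field.
Qed.
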